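(* Let $l,T>0$, $\alpha\in(0,1)$, and let $\mu\in C([0,T])$ satisfy $0<\mu_0\le\mu(t)\le\mu_{\max}$ for $t\in[0,T]$. Let $\{\mathbf u^k\}_{k=0}^M\subset\mathbb R^{N-1}$ be generated, from an initial vector $\mathbf u^0\in\mathbb R^{N-1}$ and source vectors $\mathbf f^1,\dots,\mathbf f^M\in\mathbb R^{N-1}$, by the fully discrete scheme described in the context. Then there exists a constant $C>0$, depending only on $T,\mu_0,\mu_{\max},C_P$ (where $C_P$ is the discrete Poincaré constant described in the context), but independent of $h$, $M$ and the time-step sizes $\tau_k$, such that for every $m\le M$, $$\max_{0\le k\le m}\|\mathbf u^k\|_h^2+\max_{0\le k\le m}\mu^k\|\nabla_h\mathbf u^k\|_h^2+\sum_{k=1}^m\tau_k\|\nabla_h\mathbf u^k\|_h^2\le C\Big(\|\mathbf u^0\|_h^2+\mu^0\|\nabla_h\mathbf u^0\|_h^2+\sum_{k=1}^m\tau_k\|\mathbf f^k\|_h^2\Big),$$ where $\mu^k=\mu(t_k)$ and $\mu^0=\mu(0)$.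
   Context: Space grid: $h=l/N$, $x_i=ih$, $i=0,\dots,N$. For $\mathbf v=(v_1,\dots,v_{N-1})^\top\in\mathbb R^{N-1}$ set $v_0=v_N=0$ and $(L_h\mathbf v)_i=(v_{i-1}-2v_i+v_{i+1})/h^2$, $i=1,\dots,N-1$. Discrete inner product and norms: $(\mathbf v,\mathbf w)_h=h\sum_{i=1}^{N-1}v_iw_i$, $\|\mathbf v\|_h=(\mathbf v,\mathbf v)_h^{1/2}$, and $\|\nabla_h\mathbf v\|_h^2=(-L_h\mathbf v,\mathbf v)_h$. $C_P$ is a constant independent of $h$ with $\lambda_{1,h}^{-1/2}\le C_P$, where $\lambda_{1,h}$ is the smallest eigenvalue of $-L_h$ (discrete Poincaré inequality). Time grid: $0=t_0<t_1<\dots<t_M=T$, $\tau_k=t_k-t_{k-1}$ (in particular the graded meshes $t_k=T(k/M)^r$, $r\ge1$). Weights: $$d_{k,j}=\frac{(t_k-t_{j-1})^{1-\alpha}-(t_k-t_j)^{1-\alpha}}{t_j-t_{j-1}},\qquad 1\le j\le k.$$ Fully discrete scheme (L1 / central difference discretisation of $\partial_t^\alpha u-u_{xx}-\mu(t)u_{xxt}=f$ with homogeneous Dirichlet conditions, $\partial_t^\alpha$ the Caputo derivative; $\mathbf f^k=(f(x_1,t_k),\dots,f(x_{N-1},t_k))^\top$): for $k=1,\dots,M$, $$\Big(\frac{d_{k,k}}{\Gamma(2-\alpha)}I-\Big(1+\frac{\mu^k}{\tau_k}\Big)L_h\Big)\mathbf u^k=\mathbf r^k+\mathbf f^k-\frac{\mu^k}{\tau_k}L_h\mathbf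 u^{k-1},$$ $$\mathbf r^k=\frac{d_{k,1}}{\Gamma(2-\alpha)}\mathbf u^0+\frac{1}{\Gamma(2-\alpha)}\sum_{j=1}^{k-1}(d_{k,j+1}-d_{k,j})\mathbf u^j.$$ *)

(* Defs.v *)
From HB Require Import structures.
From mathcomp Require Export all_boot all_order all_algebra.
From mathcomp Require Export all_classical all_reals all_analysis.
From mathcomp Require Import ring.
Export Order.TTheory GRing.Theory Num.Theory.
Export numFieldNormedType.Exports.
#[export] Set Implicit Arguments.
#[export] Unset Strict Implicit.
#[export] Unset Printing Implicit Defensive.

Local Open Scope classical_set_scope.
Local Open Scope ring_scope.

(* Row-vector index i : 'I_N.-1 stands for the interior node x_{i+1}. *)

(* The grid values v_0, ..., v_N, with v_0 = v_N = 0. *)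
Definition grid (R : realType) (N : nat) (v : 'rV[R]_N.-1) (i : nat) : R :=
  if i is j.+1 then oapp (v ord0) 0 (insub j) else 0.

Definition Lh (R : realType) (l : R) (N : nat) (v : 'rV[R]_N.-1) :
    'rV[R]_N.-1 :=
  \row_(i < N.-1)
    ((grid v i - 2 * grid v i.+1 + grid v i.+2) / (l / N%:R) ^+ 2).

Lemma Lh_is_linear (R : realType) (l : R) (N : nat) : linear (@Lh R l N).
Proof.
have gridP a (u v : 'rV[R]_N.-1) i :
    grid (a *: u + v) i = a * grid u i + grid v i.
  case: i => [|i] /=; first by rewrite mulr0 addr0.
  by case: insub => [j|] /=; rewrite ?mxE // mulr0 addr0.
move=> a u v; apply/rowP => i; rewrite !mxE !gridP; ring.
Qed.

HB.instance Definition _ (R : realType) (l : R) (N : nat) :=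
  GRing.isLinear.Build R 'rV[R]_N.-1 'rV[R]_N.-1 *:%R (@Lh R l N)
    (@Lh_is_linear R l N).

Definition inner_h (R : realType) (l : R) (N : nat) (v w : 'rV[R]_N.-1) : R :=
  (l / N%:R) * \sum_(i < N.-1) v ord0 i * w ord0 i.

Definition norm_h (R : realType) (l : R) (N : nat) (v : 'rV[R]_N.-1) : R :=
  Num.sqrt (inner_h l v v).

Definition sqr_grad_h (R : realType) (l : R) (N : nat) (v : 'rV[R]_N.-1) : R :=
  inner_h l (- Lh l v) v.

Definition smallest_eigenvalue (R : realType) (n : nat) (A : 'M[R]_n)
    (a : R) : Prop :=
  eigenvalue A a /\ (forall b, eigenvalue A b -> a <= b).

(* One constant for all grids h = l / N on [0, l]. *)
Definition discrete_poincare_constant (R : realType) (l CP : R) : Prop :=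
  forall N : nat, (1 < N)%N ->
    exists2 lam : R,
      smallest_eigenvalue (- lin1_mx (@Lh R l N)) lam
      & (Num.sqrt lam)^-1 <= CP.

Definition Gamma (R : realType) (x : R) : R :=
  \int[@lebesgue_measure R]_(s in `]0, +oo[) (s `^ (x - 1) * expR (- s)).

Definition time_grid (R : realType) (T : R) (M : nat) (t : nat -> R) : Prop :=
  [/\ t 0%N = 0, t M = T & forall k, (k < M)%N -> t k < t k.+1].

Definition tau (R : realType) (t : nat -> R) (k : nat) : R := t k - t k.-1.

Definition dL1 (R : realType) (alpha : R) (t : nat -> R) (k j : nat) : R :=
  ((t k - t j.-1) `^ (1 - alpha) - (t k - t j) `^ (1 - alpha))
    / (t j - t j.-1).

Definition history (R : realType) (alpha : R) (t : nat -> R) (N : nat)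
    (u : nat -> 'rV[R]_N.-1) (k : nat) : 'rV[R]_N.-1 :=
  (dL1 alpha t k 1 / Gamma (2 - alpha)) *: u 0%N +
  (Gamma (2 - alpha))^-1 *:
    \sum_(1 <= j < k) (dL1 alpha t k j.+1 - dL1 alpha t k j) *: u j.

Definition discrete_scheme (R : realType) (l alpha : R) (mu : R -> R)
    (N M : nat) (t : nat -> R) (u f : nat -> 'rV[R]_N.-1) : Prop :=
  forall k, (1 <= k <= M)%N ->
    (dL1 alpha t k k / Gamma (2 - alpha)) *: u k
      - (1 + mu (t k) / tau t k) *: Lh l (u k)
    = history alpha t u k + f k - (mu (t k) / tau t k) *: Lh l (u k.-1).

(* max_{0 <= k <= m} a_k *)
Definition max_upto (R : realType) (a : nat -> R) (m : nat) : R :=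
  \big[Num.max/a 0%N]_(k < m.+1) a k.

(* Main.v *)
Require Import Defs.
From mathcomp Require Import ring lra.
Local Open Scope classical_set_scope.
Local Open Scope ring_scope.

(** The estimate comes from testing the scheme at step k with the increment
    w_k = u^k - u^(k-1). By summation by parts the history term turns the
    L1 operator into (1 / Gamma (2 - alpha)) sum_(j <= k) d_(k,j) w_j, so that
    the scheme reads

      (1 / Gamma (2 - alpha)) sum_(j <= k) d_(k,j) w_j
        - L_h u^k - (mu^k / tau_k) L_h w_k = f^k.

    The four resulting terms are treated as follows.

    - The memory form sum_k sum_(j <= k) d_(k,j) (w_j, w_k)_h is nonnegative
      on every mesh ([convolution_form_ge0], [memory_ge0]). Rewritten with the
      jumps d_(k,j) - d_(k,j-1), it telescopes up to nonnegative terms as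
      soon as these jumps are nonnegative and nonincreasing in k. Both facts
      say that difference quotients of x^p - e (d + x)^p, p = 1 - alpha, are
      nonincreasing, with e = 0 and e = 1; by the mean value theorem they
      follow from the monotonicity of x^(p-1) - e (d + x)^(p-1).

    - (- L_h u^k, w_k)_h is at least half the increment of the squared
      gradient norm ([inner_h_Lh_diff]).

    - (mu^k / tau_k) |grad w_k|^2 is nonnegative and, through mu0 <= mu^k, absorbs
      the w_k part of (f^k, w_k)_h <= (P tau_k / (4 mu0)) |f^k|^2
      + (mu0 / (P tau_k)) |w_k|^2, where |w|^2 <= P |grad w|^2.

    Testing with w_k rather than u^k keeps mu^k in front of a square, so that
    no difference of values of mu has to be controlled. Summing over k bounds
    |grad u^m|^2 by |grad u^0|^2 + (P / (2 mu0)) sum_k tau_k |f^k|^2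
    ([gradient_estimate]), and the three quantities of the theorem are at most
    P, mumax and T times the largest squared gradient norm.

    The constant P = 8 CP^2 has to be independent of l: an elementary
    inequality gives |v|^2 <= l^2 |grad v|^2 ([discrete_friedrichs]), and on the
    grid with one interior node the only eigenvalue of - L_h is 8 / l^2, hence
    l^2 <= 8 CP^2 ([length_le_poincare]). *)

(** * Difference quotients of differences of powers *)

Lemma is_derive1_continuous (R : realType) (f : R -> R) (x df : R) :
  is_derive x 1 f df -> {for x, continuous f}.
Proof.
by case=> fx _; apply: differentiable_continuous; apply/derivable1_diffP.
Qed.

Lemma powR_cvg_right (R : realType) (p a : R) : 0 < p -> 0 <= a ->
  x `^ p @[x --> a^'+] --> a `^ p.
Proof.
move=> p0; rewrite le_eqVlt => /predU1P[<-|a0].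
  by rewrite powR0 ?gt_eqF//; exact: powR_cvg0.
apply: cvg_at_right_filter.
exact: (is_derive1_continuous (is_derive1_powR p a0)).
Qed.

Lemma is_derive1_powR_shift (R : realType) (p d x : R) : 0 < d + x ->
  is_derive x 1 (fun z => (d + z) `^ p) (p * (d + x) `^ (p - 1)).
Proof.
move=> dx0; have h : is_derive x 1 (fun z : R => d + z) (0 + 1).
  exact: is_deriveD.
by have := is_derive1_comp (is_derive1_powR p dx0) h; rewrite add0r mulr1.
Qed.

(** The interval may start at x = 0, where the power is only continuous from
    the right: this is the last cell [t_(k-1), t_k] of the L1 formula. *)
Lemma powR_diff_MVT (R : realType) (p e d x y : R) :
  0 < p -> 0 < d -> 0 <= x -> x < y ->
  exists2 c, x < c < y &
    (y `^ p - e * (d + y) `^ p) - (x `^ p - e * (d + x) `^ p)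
    = p * (c `^ (p - 1) - e * (d + c) `^ (p - 1)) * (y - x).
Proof.
move=> p0 d0 x0 xy.
pose f z : R := z `^ p - e * (d + z) `^ p.
pose df z : R := p * (z `^ (p - 1) - e * (d + z) `^ (p - 1)).
have fdf (z : R) : 0 < z -> is_derive z 1 f (df z).
  move=> z0; have dz0 : 0 < d + z by rewrite addr_gt0.
  have h := is_deriveZ e (is_derive1_powR_shift p dz0).
  have := is_deriveB (is_derive1_powR p z0) h.
  rewrite (_ : _ - _ = df z)//.
  by rewrite /df /GRing.scale/=; ring.
have fc (z : R) : 0 < z -> {for z, continuous f}.
  by move=> z0; exact: is_derive1_continuous (fdf z z0).
have [||c] := @MVT R f df x y xy.
- move=> z; rewrite in_itv/= => /andP[xz _]; apply: fdf.
  exact: le_lt_trans xz.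
- apply/(continuous_within_itvP _ xy); split.
  + move=> z; rewrite in_itv/= => /andP[xz _]; apply: fc; exact: le_lt_trans xz.
  + apply: cvgB; first exact: powR_cvg_right.
    apply: cvgM; first exact: cvg_cst.
    have dx0 : 0 < d + x by rewrite ltr_wpDr.
    apply: cvg_at_right_filter.
    exact: (is_derive1_continuous (is_derive1_powR_shift p dx0)).
  + apply: cvg_at_left_filter; apply: fc; exact: le_lt_trans xy.
- by rewrite in_itv/= => cxy E; exists c.
Qed.

Lemma powR_nonincr (R : realType) (q x y : R) :
  q <= 0 -> 0 < x -> x <= y -> y `^ q <= x `^ q.
Proof.
move=> q0 x0 xy; have y0 : 0 < y by exact: lt_le_trans xy.
rewrite -(opprK q) !(powRN _ (- q)) lef_pV2 ?posrE ?powR_gt0//.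
by rewrite ge0_ler_powR ?nnegrE ?oppr_ge0// ltW.
Qed.

Lemma powR_diff_ge0 (R : realType) (q e d x : R) :
  q <= 0 -> e <= 1 -> 0 <= d -> 0 < x -> 0 <= x `^ q - e * (d + x) `^ q.
Proof.
move=> q0 e1 d0 x0; rewrite subr_ge0.
apply: (@le_trans _ _ ((d + x) `^ q)); first by rewrite ler_piMl ?powR_ge0.
by apply: powR_nonincr => //; rewrite lerDr.
Qed.

(** The difference factors as z^q (1 - e (d / z + 1)^q), a product of two
    nonnegative factors that both decrease in z, since q <= 0. *)
Lemma powR_diff_nonincr (R : realType) (q e d x y : R) :
  q <= 0 -> 0 <= e <= 1 -> 0 <= d -> 0 < x -> x <= y ->
  y `^ q - e * (d + y) `^ q <= x `^ q - e * (d + x) `^ q.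
Proof.
move=> q0 /andP[e0 e1] d0 x0 xy.
have y0 : 0 < y by exact: lt_le_trans xy.
have E (z : R) : 0 < z -> z `^ q - e * (d + z) `^ q =
    z `^ q * (1 - e * (d / z + 1) `^ q).
  move=> z0; have -> : d + z = z * (d / z + 1) by field; rewrite gt_eqF.
  rewrite powRM ?ltW//; last by rewrite ltr_wpDl// divr_ge0// ltW.
  by ring.
rewrite !E//; apply: ler_pM; rewrite ?powR_ge0 ?powR_nonincr//.
  have := @powR_diff_ge0 R q e (d / y) 1 q0 e1.
  by rewrite powR1; apply => //; rewrite divr_ge0// ltW.
rewrite lerD2l lerN2 ler_wpM2l// powR_nonincr//.
  by rewrite ltr_wpDl// divr_ge0// ltW.
by rewrite lerD2r ler_wpM2l// lef_pV2.
Qed.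

(** With e = 0 this is the difference quotient that defines an L1 weight, with
    e = 1 it is the decrease of the weight when t_k is moved forward by d;
    keeping e as a parameter lets one mean value argument serve both. *)
Definition powR_slope (R : realType) (p e d x y : R) : R :=
  ((y `^ p - e * (d + y) `^ p) - (x `^ p - e * (d + x) `^ p)) / (y - x).

Lemma powR_slope_ge0 (R : realType) (p e d x y : R) :
  0 < p <= 1 -> e <= 1 -> 0 < d -> 0 <= x -> x < y ->
  0 <= powR_slope p e d x y.
Proof.
move=> /andP[p0 p1] e1 d0 x0 xy.
have [c /andP[xc _] E] := powR_diff_MVT e p0 d0 x0 xy.
rewrite /powR_slope E mulfK; last by rewrite subr_eq0 gt_eqF.
rewrite mulr_ge0 ?(ltW p0)// powR_diff_ge0 ?subr_le0 ?(ltW d0)//.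
exact: le_lt_trans xc.
Qed.

Lemma powR_slope_nonincr (R : realType) (p e d x y z : R) :
  0 < p <= 1 -> 0 <= e <= 1 -> 0 < d -> 0 <= x -> x < y -> y < z ->
  powR_slope p e d y z <= powR_slope p e d x y.
Proof.
move=> /andP[p0 p1] e01 d0 x0 xy yz.
have y0 := le_lt_trans x0 xy.
have [c /andP[xc cy] E] := powR_diff_MVT e p0 d0 x0 xy.
have [c' /andP[yc' _] E'] := powR_diff_MVT e p0 d0 (ltW y0) yz.
rewrite /powR_slope E E' !mulfK ?subr_eq0 ?(gt_eqF xy) ?(gt_eqF yz)//.
rewrite ler_wpM2l ?(ltW p0)// powR_diff_nonincr ?subr_le0 ?(ltW d0)//.
  exact: le_lt_trans xc.
exact: ltW (lt_trans cy yc').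
Qed.

(** * Positivity of convolution forms *)

Definition jump (R : realType) (a : nat -> R) (j : nat) : R :=
  if j is i.+1 then a j - a i else a 0%N.

Lemma sum_jump (R : realType) (a : nat -> R) (k : nat) :
  \sum_(j < k.+1) jump a j = a k.
Proof.
elim: k => [|k IH]; first by rewrite big_ord1.
by rewrite big_ord_recr/= IH addrC subrK.
Qed.

Lemma sum_increments (R : realType) (V : lmodType R) (a : nat -> R)
    (u : nat -> V) (k : nat) :
  \sum_(j < k.+1) a j *: (u j.+1 - u j)
  = a k *: u k.+1 - \sum_(j < k.+1) jump a j *: u j.
Proof.
elim: k => [|k IH]; first by rewrite !big_ord1 scalerBr.
rewrite big_ord_recr/= IH [in RHS]big_ord_recr/=.
rewrite scalerBr scalerBl opprD opprB (addrC (a k *: _)) -addrA [RHS]addrCA.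
by congr (_ + _); exact: addrCA.
Qed.

(** Summing by parts in j, the k-th term is the sum over j of
    jump (a k) j * (u (k+1) - u j) times u (k+1) - u k, and
    2 (x - z) (x - y) >= (x - z)^2 - (y - z)^2. So twice the k-th term
    dominates E' - E'', where E' is the left-hand side with m = k + 1 and E''
    is the left-hand side with m = k, but with the jumps of row k instead of
    those of row k - 1; monotonicity in k makes E'' at most the latter, and
    the sum telescopes. *)
Lemma convolution_form_ge (R : realType) (a : nat -> nat -> R) (u : nat -> R)
    (m : nat) :
  (forall k j, (j <= k < m)%N -> 0 <= jump (a k) j) ->
  (forall k j, (j <= k)%N -> (k.+1 < m)%N -> jump (a k.+1) j <= jump (a k) j) ->
  \sum_(j < m) jump (a m.-1) j * (u m - u j) ^+ 2 <=
  2 * \sum_(k < m)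
    (\sum_(j < k.+1) a k j * (u j.+1 - u j)) * (u k.+1 - u k).
Proof.
elim: m => [|m IH] jump0 jumpS; first by rewrite !big_ord0 mulr0.
have jkS k j : (j <= k < m)%N -> (j <= k < m.+1)%N.
  by move=> /andP[-> /ltnW].
rewrite [X in _ <= 2 * X]big_ord_recr/= mulrDr.
have {}IH := IH (fun k j jkm => jump0 k j (jkS k j jkm))
  (fun k j jk km => jumpS k j jk (ltnW km)).
set w := u m.+1 - u m.
have -> : \sum_(j < m.+1) a m j * (u j.+1 - u j)
    = \sum_(j < m.+1) jump (a m) j * (u m.+1 - u j).
  rewrite (@sum_increments _ R^o (a m) u m) -sum_jump /GRing.scale/=.
  by rewrite mulr_suml -sumrB; apply: eq_bigr => j _; rewrite mulrBr.
set X := (X in _ <= 2 * X) in IH; rewrite -/X.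
have old : \sum_(j < m) jump (a m) j * (u m - u j) ^+ 2 <= 2 * X.
  apply: le_trans IH; apply: ler_sum => j _; rewrite ler_wpM2r ?sqr_ge0//.
  case: m jumpS j {jump0 w X jkS} => [|m] jumpS j; [by case: j|].
  by apply: jumpS => //; rewrite -ltnS ltn_ord.
apply: le_trans (lerD old (lexx _)).
(* The term j = m vanishes, so both sums can range over j <= m. *)
have -> : \sum_(j < m) jump (a m) j * (u m - u j) ^+ 2
    = \sum_(j < m.+1) jump (a m) j * (u m - u j) ^+ 2.
  by rewrite big_ord_recr/= subrr expr0n/= mulr0 addr0.
rewrite mulrA mulr_sumr mulr_suml -big_split/=; apply: ler_sum => j _.
rewrite -subr_ge0 (_ : _ - _ = jump (a m) j * w ^+ 2).
  by rewrite mulr_ge0 ?sqr_ge0// jump0// ltnSn andbT -ltnS ltn_ord.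
by rewrite /w; ring.
Qed.

Lemma convolution_form_ge0 (R : realType) (a : nat -> nat -> R) (u : nat -> R)
    (m : nat) :
  (forall k j, (j <= k < m)%N -> 0 <= jump (a k) j) ->
  (forall k j, (j <= k)%N -> (k.+1 < m)%N -> jump (a k.+1) j <= jump (a k) j) ->
  0 <= \sum_(k < m) (\sum_(j < k.+1) a k j * (u j.+1 - u j)) * (u k.+1 - u k).
Proof.
move=> jump0 jumpS; rewrite -(@pmulr_rge0 _ 2)//.
apply: le_trans (convolution_form_ge u jump0 jumpS).
case: m jump0 {jumpS} => [|m] jump0; first by rewrite big_ord0.
apply: sumr_ge0 => j _; rewrite mulr_ge0 ?sqr_ge0// jump0// ltnSn andbT.
by rewrite -ltnS ltn_ord.
Qed.

(** * Monotonicity of the L1 weights *)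

Section kernel.
Variables (R : realType) (alpha : R) (t : nat -> R) (M : nat).
Hypothesis alpha01 : 0 < alpha < 1.
Hypothesis t_incr : forall k, (k < M)%N -> t k < t k.+1.

Lemma time_grid_lt i j : (i < j <= M)%N -> t i < t j.
Proof.
elim: j => // j IH /andP[]; rewrite ltnS leq_eqVlt.
move=> /predU1P[-> /t_incr//|ij jM].
by rewrite (lt_trans _ (t_incr jM))// IH// ij ltnW.
Qed.

Lemma time_grid_le i j : (i <= j <= M)%N -> t i <= t j.
Proof.
rewrite leq_eqVlt => /andP[/predU1P[->//|ij] jM].
by rewrite ltW ?time_grid_lt ?ij.
Qed.

Lemma dL1_slope d k j :
  dL1 alpha t k j.+1 = powR_slope (1 - alpha) 0 d (t k - t j.+1) (t k - t j).
Proof.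
by rewrite /dL1/powR_slope /= !mul0r !subr0; congr (_ / _); ring.
Qed.

Lemma dL1_diff_slope k j : dL1 alpha t k j.+1 - dL1 alpha t k.+1 j.+1
  = powR_slope (1 - alpha) 1 (t k.+1 - t k) (t k - t j.+1) (t k - t j).
Proof.
rewrite /dL1/powR_slope /= !mul1r !addrA !subrK -mulrBl.
by congr (_ / _); ring.
Qed.

Let p01 : 0 < 1 - alpha <= 1.
Proof. by case/andP: alpha01 => a0 a1; apply/andP; split; lra. Qed.

(** Seen from t_k, the cell [t_(j-1), t_j] is the interval
    [t_k - t_j, t_k - t_(j-1)]; later cells lie further to the left, where the
    concave function x^(1 - alpha) is steeper. *)
Lemma jump_dL1_ge0 k j : (j <= k < M)%N ->
  0 <= jump (fun i => dL1 alpha t k.+1 i.+1) j.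
Proof.
move=> /andP[jk kM]; have tj : t j < t j.+1.
  by apply: t_incr; exact: leq_ltn_trans kM.
have tk : t j.+1 <= t k.+1 by apply: time_grid_le; rewrite ltnS jk.
case: j jk tj tk => [|j] jk tj tk /=.
  by rewrite (dL1_slope 1) powR_slope_ge0//; lra.
have tj' : t j < t j.+1 by apply: t_incr; rewrite (leq_trans jk)// ltnW.
rewrite subr_ge0 !(dL1_slope 1) powR_slope_nonincr//; lra.
Qed.

(** The same comparison of neighbouring cells for
    x^(1 - alpha) - (d + x)^(1 - alpha), with d the step from t_k to t_(k+1):
    its concavity reflects the convexity of the kernel s^(- alpha). *)
Lemma jump_dL1_nonincr k j : (j <= k)%N -> (k.+1 < M)%N ->
  jump (fun i => dL1 alpha t k.+2 i.+1) j
    <= jump (fun i => dL1 alpha t k.+1 i.+1) j.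
Proof.
move=> jk kM; have tj : t j < t j.+1.
  by apply: t_incr; exact: (leq_ltn_trans jk (ltnW kM)).
have tk : t j.+1 <= t k.+1 by apply: time_grid_le; rewrite ltnS jk ltnW.
have tkS := t_incr kM.
case: j jk tj tk => [|j] jk tj tk /=; rewrite -subr_ge0.
  by rewrite dL1_diff_slope powR_slope_ge0//; lra.
have tj' : t j < t j.+1 by apply: t_incr; rewrite (leq_trans jk)// ltnW// ltnW.
set e1 := dL1 _ _ _ _; set e2 := dL1 _ _ _ _; set e3 := dL1 _ _ _ _.
set e4 := dL1 _ _ _ _.
have -> : e1 - e2 - (e3 - e4) = (e1 - e3) - (e2 - e4) by ring.
rewrite /e1 /e2 /e3 /e4 !dL1_diff_slope subr_ge0.
by apply: powR_slope_nonincr; rewrite ?ler01 ?lexx//; lra.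
Qed.
End kernel.

(** * The discrete inner product and gradient *)

Section inner.
Variables (R : realType) (l : R).
Hypothesis l0 : 0 < l.

Section anyN.
Variable (N : nat).
Implicit Types u v w : 'rV[R]_N.-1.

Lemma inner_hDl u v w : inner_h l (u + v) w = inner_h l u w + inner_h l v w.
Proof.
rewrite /inner_h -mulrDr -big_split/=; congr (_ * _).
by apply: eq_bigr => i _; rewrite mxE mulrDl.
Qed.

Lemma inner_hZl c v w : inner_h l (c *: v) w = c * inner_h l v w.
Proof.
rewrite /inner_h mulrCA [X in _ = _ * X]mulr_sumr; congr (_ * _).
by apply: eq_bigr => i _; rewrite mxE mulrA.
Qed.

Lemma inner_h_ge0 v : 0 <= inner_h l v v.
Proof.
rewrite /inner_h mulr_ge0 ?divr_ge0 ?(ltW l0)// sumr_ge0// => i _.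
by rewrite -expr2 sqr_ge0.
Qed.

Lemma norm_h_sqr v : norm_h l v ^+ 2 = inner_h l v v.
Proof. by rewrite sqr_sqrtr// inner_h_ge0. Qed.

Lemma inner_h_young v w (c : R) : 0 < c ->
  inner_h l v w <= c / 4 * inner_h l v v + c^-1 * inner_h l w w.
Proof.
move=> c0; rewrite /inner_h !(mulrCA _ (l / _)) -mulrDr.
rewrite ler_wpM2l ?divr_ge0 ?(ltW l0)// !mulr_sumr -big_split/=.
apply: ler_sum => i _; set x := v _ _; set y := w _ _.
rewrite -subr_ge0 (_ : _ - _ = (c / 2 * x - y) ^+ 2 / c).
  by rewrite divr_ge0 ?sqr_ge0 ?(ltW c0).
by field; rewrite gt_eqF.
Qed.
End anyN.

Section grid.
Variable n : nat.
Let N := n.+1.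
Let h : R := l / N%:R.
Implicit Types v w : 'rV[R]_N.-1.

Lemma grid_inner v (i : 'I_n) : grid v i.+1 = v ord0 i.
Proof. by rewrite /= valK. Qed.

Lemma grid_last v : grid v N = 0.
Proof. by rewrite /= insubF//= ltnn. Qed.

Definition fdiff v (i : nat) : R := (grid v i.+1 - grid v i) / h.

Lemma h_gt0 : 0 < h.
Proof. by rewrite divr_gt0// ltr0n. Qed.

Lemma sum_by_parts (a b : nat -> R) (k : nat) :
  \sum_(i < k.+1) a i * (b i.+1 - b i)
  = a k * b k.+1 - a 0%N * b 0%N - \sum_(i < k) (a i.+1 - a i) * b i.+1.
Proof.
elim: k => [|k IH]; first by rewrite big_ord1 big_ord0; ring.
by rewrite big_ord_recr IH/= [in RHS]big_ord_recr/=; ring.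
Qed.

(** Summation by parts; the boundary terms vanish because w is extended by
    zero. *)
Lemma inner_h_Lh v w :
  inner_h l (- Lh l v) w = h * \sum_(i < N) fdiff v i * fdiff w i.
Proof.
have -> : \sum_(i < N) fdiff v i * fdiff w i
    = \sum_(i < N) (fdiff v i / h) * (grid w i.+1 - grid w i).
  by apply: eq_bigr => i _; rewrite {2}/fdiff; field; rewrite (gt_eqF h_gt0).
have grid0 : grid w 0 = 0 by [].
rewrite (sum_by_parts (fun i => fdiff v i / h) (grid w)) -/N grid_last grid0.
rewrite !mulr0 subr0 sub0r -sumrN.
congr (_ * _); apply: eq_bigr => i _; rewrite !mxE -grid_inner -[RHS]mulNr.
congr (_ * _); rewrite /fdiff -/h.
by field; rewrite (gt_eqF h_gt0).
Qed.

Lemma sqr_grad_hE v : sqr_grad_h l v = h * \sum_(i < N) fdiff v i ^+ 2.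
Proof. by rewrite /sqr_grad_h inner_h_Lh. Qed.

Lemma sqr_grad_h_ge0 v : 0 <= sqr_grad_h l v.
Proof.
rewrite sqr_grad_hE mulr_ge0 ?(ltW h_gt0)// sumr_ge0// => i _.
by rewrite sqr_ge0.
Qed.

Lemma inner_h_Lh_diff v w :
  (sqr_grad_h l v - sqr_grad_h l w) / 2 <= inner_h l (- Lh l v) (v - w).
Proof.
have fdiffB i : fdiff (v - w) i = fdiff v i - fdiff w i.
  have gB j : grid (v - w) j = grid v j - grid w j.
    case: j => [|j] /=; first by rewrite subr0.
    by case: insub => [k|] /=; rewrite ?mxE ?subr0.
  by rewrite /fdiff !gB; ring.
rewrite !sqr_grad_hE inner_h_Lh -mulrBr -mulrA ler_wpM2l ?(ltW h_gt0)//.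
rewrite -sumrB mulr_suml; apply: ler_sum => i _; rewrite fdiffB.
have := sqr_ge0 (fdiff v i - fdiff w i); nra.
Qed.

Lemma sqr_le_sum_increments (b : nat -> R) (i : nat) : b 0%N = 0 ->
  b i ^+ 2 <= i%:R * \sum_(j < i) (b j.+1 - b j) ^+ 2.
Proof.
move=> b0; elim: i => [|i IH]; first by rewrite b0 expr0n/= mul0r.
rewrite big_ord_recr/=; set S := \sum_(j < i) _ in IH *; set e := b i.+1 - b i.
have -> : b i.+1 = b i + e by rewrite addrC subrK.
case: i @S e IH => [|i] S e IH; first by rewrite /S big_ord0 b0; lra.
have : 0 < i.+1%:R :> R by rewrite ltr0n.
rewrite -[i.+2]addn1 natrD; set c := i.+1%:R in IH * => c0.
have : 2 * b i.+1 * e <= S + c * e ^+ 2.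
  rewrite -(ler_pM2l c0); have := sqr_ge0 (b i.+1 - c * e); nra.
by lra.
Qed.

(** By the Cauchy-Schwarz inequality of [sqr_le_sum_increments], every nodal
    value satisfies v_i^2 <= N h^2 sum_j (fdiff v j)^2; summing fewer than N
    such bounds with weight h gives the factor (N h)^2 = l^2. *)
Lemma discrete_friedrichs v : inner_h l v v <= l ^+ 2 * sqr_grad_h l v.
Proof.
have Nh : N%:R * h = l by rewrite /h; field; rewrite pnatr_eq0.
rewrite sqr_grad_hE /inner_h -/h mulrCA ler_wpM2l ?(ltW h_gt0)//.
set S := \sum_(i < N) _.
have S0 : 0 <= S by apply: sumr_ge0 => i _; rewrite sqr_ge0.
have pt (i : 'I_n) : v ord0 i * v ord0 i <= N%:R * h ^+ 2 * S.
  rewrite -grid_inner -expr2.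
  apply: le_trans (@sqr_le_sum_increments (grid v) i.+1 erefl) _.
  rewrite -mulrA; apply: ler_pM => //.
  - by apply: sumr_ge0 => j _; exact: sqr_ge0.
  - by rewrite ler_nat ltnS ltnW.
  have -> : h ^+ 2 * S = \sum_(j < N) (grid v j.+1 - grid v j) ^+ 2.
    rewrite mulr_sumr; apply: eq_bigr => j _.
    by rewrite /fdiff; field; rewrite (gt_eqF h_gt0).
  have iN : (i.+1 <= N)%N by rewrite ltnS ltnW.
  rewrite (big_ord_widen _ (fun j => (grid v j.+1 - grid v j) ^+ 2) iN).
  by rewrite big_mkcond/=; apply: ler_sum => j _; case: ifP; rewrite ?sqr_ge0.
apply: (@le_trans _ _ (\sum_(i < N.-1) N%:R * h ^+ 2 * S)).
  by apply: ler_sum => i _; exact: pt.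
have -> : l ^+ 2 = N%:R * N%:R * h ^+ 2 by rewrite -Nh; ring.
rewrite sumr_const card_ord -(mulr_natl _ N.-1) mulrA ler_wpM2r//.
by rewrite mulrA ler_wpM2r ?sqr_ge0// ler_wpM2r// ler_nat.
Qed.
End grid.

(** On the grid with N = 2, - L_h is multiplication by 2 / (l / 2)^2 = 8 / l^2,
    so a constant valid on all grids controls the length of the interval. *)
Lemma length_le_poincare (CP : R) :
  discrete_poincare_constant l CP -> l ^+ 2 <= 8 * CP ^+ 2.
Proof.
move=> /(_ 2%N isT)[lam [/eigenvalueP[v vlam v0] _] lamCP].
have lamE : lam = 8 / l ^+ 2.
  have := vlam; rewrite mulmxN mul_rV_lin1 => /matrixP/(_ ord0 ord0).
  rewrite !mxE (_ : grid v (ord0 : 'I_1) = 0)// (@grid_last 1 v).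
  rewrite (@grid_inner 1 v ord0 : grid v 1 = _).
  have v00 : v ord0 ord0 != 0.
    apply: contraNneq v0 => v00; apply/eqP/rowP => i.
    by rewrite (ord1 i) v00 mxE.
  move=> E; apply: (mulIf v00); rewrite -E.
  by field; rewrite gt_eqF.
have lam0 : 0 < lam by rewrite lamE divr_gt0// exprn_gt0.
have sq0 : 0 < (Num.sqrt lam)^-1 by rewrite invr_gt0 sqrtr_gt0.
have : (Num.sqrt lam)^-1 ^+ 2 <= CP ^+ 2.
  by rewrite ler_pXn2r// nnegrE ltW// (lt_le_trans sq0).
rewrite exprVn sqr_sqrtr ?(ltW lam0)// lamE invf_div.
lra.
Qed.
End inner.

Lemma Gamma_ge0 (R : realType) (x : R) : 0 <= Gamma x.
Proof.
by apply: Rintegral_ge0 => s _; rewrite mulr_ge0 ?powR_ge0 ?expR_ge0.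
Qed.

(** * The energy estimate *)

Section energy.
Variables (R : realType) (l alpha : R) (mu : R -> R) (n M : nat).
Variables (t : nat -> R) (u f : nat -> 'rV[R]_(n.+1).-1).
Hypotheses (l0 : 0 < l) (alpha01 : 0 < alpha < 1).
Hypothesis t_incr : forall k, (k < M)%N -> t k < t k.+1.
Hypothesis scheme : discrete_scheme l alpha mu M t u f.

Let a (k j : nat) : R := dL1 alpha t k.+1 j.+1.
Let w (k : nat) := u k.+1 - u k.

Lemma history_jump k : history alpha t u k.+1
  = (Gamma (2 - alpha))^-1 *: \sum_(j < k.+1) jump (a k) j *: u j.
Proof.
rewrite /history big_ord_recl scalerDr scalerA -/(a k 0).
rewrite [(Gamma _)^-1 * _]mulrC; congr (_ + _ *: _).
by rewrite big_add1 big_mkord.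
Qed.

Lemma scheme_increments k : (k < M)%N ->
  (Gamma (2 - alpha))^-1 *: (\sum_(j < k.+1) a k j *: w j) - Lh l (u k.+1)
    - (mu (t k.+1) / tau t k.+1) *: Lh l (w k)
  = f k.+1.
Proof.
move=> kM; have /= := @scheme k.+1; rewrite kM => /(_ isT).
rewrite history_jump sum_increments linearB/= -/(a k k).
set J := \sum_(j < _) _; set g := (Gamma _)^-1; set c := _ / tau _ _ => E.
apply: (addrI (g *: J)); apply: (addIr (- (c *: Lh l (u k)))); rewrite -E.
rewrite /w linearB/= !scalerBr scalerDl scale1r scalerA [g * _]mulrC.
move: (g *: J) (_ *: u k.+1) (Lh l _) (c *: Lh l (u k.+1)) (c *: Lh l (u k)).
by move=> x1 x2 x3 x4 x5; apply/rowP => i; rewrite !mxE; ring.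
Qed.

(** The form splits into one scalar form for each grid node. *)
Lemma memory_ge0 m : (m <= M)%N ->
  0 <= \sum_(k < m) inner_h l (\sum_(j < k.+1) a k j *: w j) (w k).
Proof.
move=> mM; rewrite /inner_h -mulr_sumr mulr_ge0 ?divr_ge0 ?(ltW l0)//.
rewrite exchange_big/= sumr_ge0// => i _.
have jge0 k j : (j <= k < m)%N -> 0 <= jump (a k) j.
  move=> /andP[jk km]; apply: (@jump_dL1_ge0 _ _ _ M) => //.
  by rewrite jk (leq_trans km).
have jle k j : (j <= k)%N -> (k.+1 < m)%N -> jump (a k.+1) j <= jump (a k) j.
  move=> jk km; apply: (@jump_dL1_nonincr _ _ _ M) => //.
  exact: leq_trans mM.
have := convolution_form_ge0 (fun k => u k ord0 i) jge0 jle.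
congr (0 <= _); apply: eq_bigr => k _; rewrite summxE !mxE; congr (_ * _).
by apply: eq_bigr => j _; rewrite !mxE.
Qed.

(** Testing with increments: the memory form is dropped and the w_k part of the
    source term is absorbed by the pseudo-parabolic term. *)
Lemma gradient_estimate (mu0 P : R) m : 0 < mu0 -> 0 < P -> (m <= M)%N ->
  (forall k, (k < M)%N -> mu0 <= mu (t k.+1)) ->
  (forall v : 'rV[R]_(n.+1).-1, inner_h l v v <= P * sqr_grad_h l v) ->
  sqr_grad_h l (u m) <= sqr_grad_h l (u 0%N)
    + P / (2 * mu0) * \sum_(k < m) tau t k.+1 * inner_h l (f k.+1) (f k.+1).
Proof.
move=> mu00 P0 mM hmu poincare.
have step k : (k < m)%N ->
    (Gamma (2 - alpha))^-1 * inner_h l (\sum_(j < k.+1) a k j *: w j) (w k)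
      + (sqr_grad_h l (u k.+1) - sqr_grad_h l (u k)) / 2
    <= P / (4 * mu0) * (tau t k.+1 * inner_h l (f k.+1) (f k.+1)).
  move=> km; have kM : (k < M)%N by exact: leq_trans mM.
  have tau0 : 0 < tau t k.+1 by rewrite subr_gt0 t_incr.
  have := congr1 (fun v => inner_h l v (w k)) (scheme_increments kM).
  rewrite -scalerN !inner_hDl !inner_hZl -/(sqr_grad_h l (w k)) => E.
  have conv := inner_h_Lh_diff l0 (u k.+1) (u k); rewrite -/(w k) in conv.
  (* This weight makes the w_k part of Young's inequality equal to
     mu0 / tau_k times |w_k|^2 / P, hence at most mu0 / tau_k |grad w_k|^2. *)
  have c0 : 0 < P * tau t k.+1 / mu0 by rewrite divr_gt0// mulr_gt0.
  have young := inner_h_young l0 (f k.+1) (w k) c0.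
  have absorb : (P * tau t k.+1 / mu0)^-1 * inner_h l (w k) (w k)
      <= mu (t k.+1) / tau t k.+1 * sqr_grad_h l (w k).
    apply: (@le_trans _ _ (mu0 / tau t k.+1 * sqr_grad_h l (w k))).
      have -> : mu0 / tau t k.+1 * sqr_grad_h l (w k)
          = (P * tau t k.+1 / mu0)^-1 * (P * sqr_grad_h l (w k)).
        by field; rewrite !gt_eqF.
      by rewrite ler_wpM2l// invr_ge0 ltW.
    by rewrite ler_wpM2r ?sqr_grad_h_ge0// ler_wpM2r ?invr_ge0 ?(ltW tau0) ?hmu.
  have -> : P / (4 * mu0) * (tau t k.+1 * inner_h l (f k.+1) (f k.+1))
      = P * tau t k.+1 / mu0 / 4 * inner_h l (f k.+1) (f k.+1).
    by field; rewrite gt_eqF.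
  by lra.
set F := (X in _ <= _ + _ * X).
have : \sum_(k < m) ((Gamma (2 - alpha))^-1
          * inner_h l (\sum_(j < k.+1) a k j *: w j) (w k)
        + (sqr_grad_h l (u k.+1) - sqr_grad_h l (u k)) / 2)
    <= \sum_(k < m)
        P / (4 * mu0) * (tau t k.+1 * inner_h l (f k.+1) (f k.+1)).
  by apply: ler_sum => k _; exact: step.
rewrite big_split/= -[X in _ <= X]mulr_sumr -mulr_suml.
rewrite -(mulr_sumr _ _ _ (Gamma _)^-1) -/F.
have -> : \sum_(k < m) (sqr_grad_h l (u k.+1) - sqr_grad_h l (u k))
    = sqr_grad_h l (u m) - sqr_grad_h l (u 0%N).
  by rewrite -(telescope_sumr (fun k => sqr_grad_h l (u k)))// big_mkord.
move=> E.
have -> : P / (2 * mu0) * F = 2 * (P / (4 * mu0) * F).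
  by field; rewrite gt_eqF.
have : 0 <= (Gamma (2 - alpha))^-1
    * \sum_(k < m) inner_h l (\sum_(j < k.+1) a k j *: w j) (w k).
  by rewrite mulr_ge0 ?invr_ge0 ?Gamma_ge0// memory_ge0.
by lra.
Qed.
End energy.

(** * The stability estimate *)

Lemma max_upto_le (R : realType) (a : nat -> R) (m : nat) (b : R) :
  (forall k, (k <= m)%N -> a k <= b) -> max_upto a m <= b.
Proof.
move=> ab; apply: bigmax_le => [|k _]; first exact: ab.
by apply: ab; rewrite -ltnS ltn_ord.
Qed.

Theorem theorem3p2 (R : realType) (T mu0 mumax CP : R)
    (hT : 0 < T) (hmu0 : 0 < mu0) :
  exists2 C : R, 0 < C &
    forall (l alpha : R) (mu : R -> R) (N M : nat) (t : nat -> R)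
      (u f : nat -> 'rV[R]_N.-1),
      0 < l ->
      0 < alpha < 1 ->
      {within `[0, T], continuous mu} ->
      (forall s, s \in `[0, T] -> mu0 <= mu s <= mumax) ->
      (1 < N)%N ->
      discrete_poincare_constant l CP ->
      time_grid T M t ->
      discrete_scheme l alpha mu M t u f ->
      forall m : nat, (m <= M)%N ->
        max_upto (fun k => norm_h l (u k) ^+ 2) m
          + max_upto (fun k => mu (t k) * sqr_grad_h l (u k)) m
          + \sum_(1 <= k < m.+1) tau t k * sqr_grad_h l (u k)
        <= C * (norm_h l (u 0%N) ^+ 2 + mu 0 * sqr_grad_h l (u 0%N)
                + \sum_(1 <= k < m.+1) tau t k * norm_h l (f k) ^+ 2).
Proof.
pose P := 8 * CP ^+ 2.
have P0 : 0 <= P by rewrite mulr_ge0 ?sqr_ge0.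
pose C := (P + `|mumax| + T) * (mu0^-1 + P / (2 * mu0)).
have K0 : 0 < P + `|mumax| + T by rewrite ltr_wpDl// addr_ge0.
have D0 : 0 <= P / (2 * mu0) by rewrite divr_ge0// mulr_ge0// ltW.
exists C; first by rewrite mulr_gt0// ltr_wpDr// invr_gt0.
move=> l alpha mu [//|n] M t u f l0 alpha01 _ hmu _ hCP [t0 tM t_incr].
move=> scheme m mM.
have lP : l ^+ 2 <= P := length_le_poincare l0 hCP.
have P_gt0 : 0 < P by rewrite (lt_le_trans _ lP)// exprn_gt0.
have poincare (v : 'rV[R]_(n.+1).-1) : inner_h l v v <= P * sqr_grad_h l v.
  apply: le_trans (discrete_friedrichs l0 v) _.
  by rewrite ler_wpM2r ?sqr_grad_h_ge0.
have tT k : (k <= M)%N -> 0 <= t k <= T.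
  move=> kM; rewrite -[X in X <= _]t0 -tM.
  by rewrite !(time_grid_le t_incr) ?kM ?leqnn.
have muk k : (k <= M)%N -> mu0 <= mu (t k) <= mumax.
  by move=> kM; apply: hmu; rewrite in_itv/= tT.
have mum k : (k < M)%N -> mu0 <= mu (t k.+1) by move=> /muk/andP[].
set F := \sum_(1 <= k < m.+1) tau t k * norm_h l (f k) ^+ 2.
have tau0 k : (k < m)%N -> 0 <= tau t k.+1.
  by move=> km; rewrite subr_ge0 ltW// t_incr// (leq_trans km).
have term0 k : (k < m)%N -> 0 <= tau t k.+1 * inner_h l (f k.+1) (f k.+1).
  by move=> km; rewrite mulr_ge0 ?tau0 ?inner_h_ge0.
have FE : F = \sum_(k < m) tau t k.+1 * inner_h l (f k.+1) (f k.+1).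
  by rewrite /F big_add1 big_mkord; apply: eq_bigr => k _; rewrite norm_h_sqr.
have F0 : 0 <= F by rewrite FE sumr_ge0// => k _; exact: term0.
pose G := sqr_grad_h l (u 0%N) + P / (2 * mu0) * F.
have gradG k : (k <= m)%N -> sqr_grad_h l (u k) <= G.
  move=> km; have kM := leq_trans km mM.
  apply: le_trans (gradient_estimate l0 alpha01 t_incr scheme hmu0 P_gt0 kM
    mum poincare) _.
  rewrite lerD2l ler_wpM2l// FE.
  pose src i := tau t i.+1 * inner_h l (f i.+1) (f i.+1).
  rewrite (big_ord_widen _ src km) big_mkcond/=; apply: ler_sum => j _.
  by case: ifP => // _; exact: term0.
have G0 : 0 <= G.
  by apply: le_trans (gradG 0%N (leq0n m)); exact: sqr_grad_h_ge0.
have max_norm : max_upto (fun k => norm_h l (u k) ^+ 2) m <= P * G.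
  apply: max_upto_le => k km; rewrite norm_h_sqr//.
  by apply: le_trans (poincare _) _; rewrite ler_wpM2l// gradG.
have max_grad :
    max_upto (fun k => mu (t k) * sqr_grad_h l (u k)) m <= `|mumax| * G.
  apply: max_upto_le => k km.
  have /andP[mu_ge mu_le] := muk k (leq_trans km mM).
  apply: ler_pM; rewrite ?sqr_grad_h_ge0 ?gradG//.
    by rewrite (le_trans (ltW hmu0)).
  exact: le_trans mu_le (ler_norm _).
have sum_grad : \sum_(1 <= k < m.+1) tau t k * sqr_grad_h l (u k) <= T * G.
  rewrite big_add1 big_mkord.
  apply: (@le_trans _ _ (\sum_(k < m) tau t k.+1 * G)).
    by apply: ler_sum => k _; rewrite ler_wpM2l ?tau0 ?gradG.
  rewrite -mulr_suml ler_wpM2r//.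
  have -> : \sum_(k < m) tau t k.+1 = t m - t 0%N.
    by rewrite -(telescope_sumr t)// big_mkord.
  by rewrite t0 subr0; case/andP: (tT m mM).
apply: (@le_trans _ _ ((P + `|mumax| + T) * G)); first by lra.
rewrite /C -mulrA ler_wpM2l ?(ltW K0)//.
have n0 : 0 <= norm_h l (u 0%N) ^+ 2 by exact: sqr_ge0.
have /andP[mu_ge _] : mu0 <= mu 0 <= mumax by rewrite -t0 muk.
have g0 := @sqr_grad_h_ge0 _ _ l0 _ (u 0%N).
have mug : mu0 * sqr_grad_h l (u 0%N) <= mu 0 * sqr_grad_h l (u 0%N).
  by rewrite ler_wpM2r.
set X := norm_h _ _ ^+ 2 + _ + F.
have XF : F <= X.
  by rewrite /X lerDr addr_ge0// (le_trans _ mug)// mulr_ge0// ltW.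
have Xg : sqr_grad_h l (u 0%N) <= mu0^-1 * X.
  rewrite -(ler_pM2l hmu0) mulVKf ?gt_eqF// /X.
  by lra.
rewrite mulrDl lerD// ler_wpM2l//.
Qed.
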